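(* Let $\mathcal{H}$ be a Hilbert space and $T$ a (possibly unbounded) self-adjoint operator on $\mathcal{H}$ with domain $D$. Assume there is an orthonormal basis $\{f_n\}_{n\in\mathbb{N}}$ of $\mathcal{H}$ with $f_n\in D$ and sequences $a_n>0$, $b_n\in\mathbb{C}$, $c_n\in\mathbb{R}$ such that $$Tf_n=a_nf_{n+2}+b_nf_{n+1}+c_nf_n+\overline{b_{n-1}}f_{n-1}+a_{n-2}f_{n-2}\qquad(n\in\mathbb{N},\ f_{-1}=f_{-2}=0).$$ Assume the spectrum is $\sigma(T)=\Omega_1\cup\Omega_2$ (disjoint), let $\sigma$ be a positive Borel measure on $\Omega_1$, $\rho$ a positive Borel measure on $\Omega_2$, $V:\Omega_2\to M_2(\mathbb{C})$ measurable with $V(\lambda)$ positive semi-definite $\rho$-a.e., and let $L^2(\mathcal{V})$ be the Hilbert space of functions $f$ with $f|_{\Omega_1}:\Omega_1\to\mathbb{C}$, $f|_{\Omega_2}:\Omega_2\to\mathbb{C}^2$ and inner product $\langle f,g\rangle=\int_{\Omega_1}f\bar g\,d\sigma+\int_{\Omega_2}g(\lambda)^\ast V(\lambda)f(\lambda)\,d\rho(\lambda)$ (modulo null functions). Assume there is a unitary $U:\mathcal{H}\to L^2(\mathcal{V})$ with $UT=MU$, $M$ multiplication by $\lambda$. Define $2\times2$ matrix polynomials $P_n$ by $P_{-1}=0$, $P_0=I$ and $\lambda P_n(\lambda)=A_nP_{n+1}(\lambda)+B_nP_n(\lambda)+A_{n-1}^\ast P_{n-1}(\lambda)$, where $$A_n=\begin{pmatrix}a_{2n}&0\\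 b_{2n+1}&a_{2n+1}\end{pmatrix},\qquad B_n=\begin{pmatrix}c_{2n}&b_{2n}\\ \overline{b_{2n}}&c_{2n+1}\end{pmatrix}.$$ Then for all $n,m\in\mathbb{N}$, $$\int_{\Omega_1}P_n(\lambda)W_1(\lambda)P_m(\lambda)^\ast d\sigma(\lambda)+\int_{\Omega_2}P_n(\lambda)W_2(\lambda)P_m(\lambda)^\ast d\rho(\lambda)=\delta_{nm}I,$$ where, $\sigma$-a.e. on $\Omega_1$, $W_1(\lambda)=\begin{pmatrix}|Uf_0(\lambda)|^2&Uf_0(\lambda)\overline{Uf_1(\lambda)}\\ \overline{Uf_0(\lambda)}Uf_1(\lambda)&|Uf_1(\lambda)|^2\end{pmatrix}$, and, $\rho$-a.e. on $\Omega_2$, $W_2(\lambda)_{i,j}=(Uf_{j-1}(\lambda))^\ast V(\lambda)\,Uf_{i-1}(\lambda)$ for $i,j\in\{1,2\}$.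
   Context: For $\lambda\in\Omega_2$, $Uf(\lambda)\in\mathbb{C}^2$ is a column vector and $(\cdot)^\ast$ is the conjugate transpose; for a matrix polynomial $P$ and real $\lambda$, $P(\lambda)^\ast$ is the conjugate transpose. *)

(* Defs.v *)
From HB Require Import structures.
From mathcomp Require Import all_boot all_order all_algebra.
From mathcomp Require Import all_classical all_reals all_analysis.
From mathcomp Require Import complex.

Set Implicit Arguments.
Unset Strict Implicit.
Unset Printing Implicit Defensive.

Import Order.TTheory GRing.Theory Num.Theory.
Local Open Scope classical_set_scope.
Local Open Scope ring_scope.

Definition toC {R : realType} (x : R) : R[i] := Complex x 0.

Section Hilbert.
Context {R : realType} {H : lmodType R[i]} (ip : H -> H -> R[i]).

Definition hnorm (x : H) : R := Num.sqrt (complex.Re (ip x x)).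

Definition inner_product_axioms : Prop :=
  [/\ (forall (a : R[i]) x y z, ip (a *: x + y) z = a * ip x z + ip y z),
      (forall x y, ip y x = Num.conj (ip x y)),
      (forall x, 0 <= ip x x)
    & (forall x, ip x x = 0 -> x = 0)].

Definition hcauchy (u : nat -> H) : Prop :=
  forall e : R, 0 < e -> exists N : nat, forall n m : nat,
    (N <= n)%N -> (N <= m)%N -> hnorm (u n - u m) < e.

Definition hconverges (u : nat -> H) (l : H) : Prop :=
  forall e : R, 0 < e -> exists N : nat, forall n : nat,
    (N <= n)%N -> hnorm (u n - l) < e.

Definition hilbert_space : Prop :=
  inner_product_axioms /\ forall u, hcauchy u -> exists l, hconverges u l.

Definition subspace (D : set H) : Prop :=
  D 0 /\ forall (a : R[i]) x y, D x -> D y -> D (a *: x + y).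

Definition hdense (D : set H) : Prop :=
  forall (x : H) (e : R), 0 < e -> exists d, D d /\ hnorm (x - d) < e.

Definition densely_defined_linear (D : set H) (T : H -> H) : Prop :=
  [/\ subspace D, hdense D &
      forall (a : R[i]) x y, D x -> D y -> T (a *: x + y) = a *: T x + T y].

Definition adjoint_domain (D : set H) (T : H -> H) : set H :=
  [set y | exists C : R, forall x, D x -> `|ip (T x) y| <= toC (C * hnorm x)].

(* T (with domain D) is self-adjoint: T is symmetric and D(T^* ) = D
   (together with symmetry and density this gives T^* = T). *)
Definition self_adjoint (D : set H) (T : H -> H) : Prop :=
  [/\ densely_defined_linear D T,
      (forall x y, D x -> D y -> ip (T x) y = ip x (T y))
    & adjoint_domain D T `<=` D].

Definition resolvent_point (D : set H) (T : H -> H) (z : R[i]) : Prop :=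
  (forall y, exists! x, D x /\ T x - z *: x = y) /\
  (exists C : R, forall x, D x -> hnorm x <= C * hnorm (T x - z *: x)).

Definition spectrum (D : set H) (T : H -> H) : set R[i] :=
  [set z | ~ resolvent_point D T z].

Definition orthonormal_basis (f : nat -> H) : Prop :=
  (forall n m, ip (f n) (f m) = (n == m)%:R) /\
  (forall x, (forall n, ip x (f n) = 0) -> x = 0).

End Hilbert.

Section L2V.
Context {R : realType}.

Definition adjmx {m n : nat} (M : 'M[R[i]]_(m, n)) : 'M[R[i]]_(n, m) :=
  (map_mx Num.conj M)^T.

Definition cint (mu : {measure set R -> \bar R}) (A : set R) (h : R -> R[i]) : R[i] :=
  Complex (Rintegral mu A (fun x => complex.Re (h x)))
          (Rintegral mu A (fun x => complex.Im (h x))).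

Definition mxint (mu : {measure set R -> \bar R}) (A : set R)
  (F : R -> 'M[R[i]]_2) : 'M[R[i]]_2 :=
  \matrix_(i < 2, j < 2) cint mu A (fun x => F x i j).

Definition cmeasurable (A : set R) (h : R -> R[i]) : Prop :=
  measurable_fun A (fun x => complex.Re (h x)) /\
  measurable_fun A (fun x => complex.Im (h x)).

Definition psd2 (M : 'M[R[i]]_2) : Prop :=
  forall v : 'cV[R[i]]_2, 0 <= (adjmx v *m M *m v) ord0 ord0.

Definition csq (z : R[i]) : R := complex.Re z ^+ 2 + complex.Im z ^+ 2.

Variables (sigma rho : {measure set R -> \bar R}) (Om1 Om2 : set R)
  (V : R -> 'M[R[i]]_2).

(* elements of L^2(V) are represented by g : R -> C^2; on Om1 only the
   first coordinate g x 0 0 is used (g|Om1 : Om1 -> C), on Om2 the whole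
   column vector g x (g|Om2 : Om2 -> C^2). *)
Definition Vform (g h : R -> 'cV[R[i]]_2) (x : R) : R[i] :=
  (adjmx (h x) *m V x *m g x) ord0 ord0.

Definition ipV (g h : R -> 'cV[R[i]]_2) : R[i] :=
  cint sigma Om1 (fun x => g x ord0 ord0 * Num.conj (h x ord0 ord0))
  + cint rho Om2 (Vform g h).

Definition inL2V (g : R -> 'cV[R[i]]_2) : Prop :=
  [/\ cmeasurable Om1 (fun x => g x ord0 ord0),
      cmeasurable Om2 (fun x => g x ord0 ord0),
      cmeasurable Om2 (fun x => g x ord_max ord0),
      sigma.-integrable Om1 (fun x => (csq (g x ord0 ord0))%:E)
    & rho.-integrable Om2 (fun x => (complex.Re (Vform g g x))%:E)].

Definition L2null (g : R -> 'cV[R[i]]_2) : Prop := ipV g g = 0.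

(* U : H -> L^2(V) unitary (onto, inner-product preserving); U x is a
   representative of the class of U x. *)
Definition unitary_to_L2V {H : lmodType R[i]} (ip : H -> H -> R[i])
  (U : H -> R -> 'cV[R[i]]_2) : Prop :=
  [/\ forall x, inL2V (U x),
      forall x y, ipV (U x) (U y) = ip x y
    & forall g, inL2V g -> exists x, L2null (fun t => U x t - g t)].

(* U T = M U as (unbounded) operators, M = multiplication by lambda on
   its maximal domain {g | lambda g in L^2(V)}: equality on D and
   equality of domains. *)
Definition intertwines_mult {H : lmodType R[i]} (D : set H) (T : H -> H)
  (U : H -> R -> 'cV[R[i]]_2) : Prop :=
  (forall x, D x -> L2null (fun t => U (T x) t - toC t *: U x t)) /\
  (forall x, inL2V (fun t => toC t *: U x t) -> D x).

End L2V.

Section Mats.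
Context {R : realType}.

Definition mx2 (x y z w : R[i]) : 'M[R[i]]_2 :=
  \matrix_(i < 2, j < 2)
    if i == ord0 then (if j == ord0 then x else y) else (if j == ord0 then z else w).

Definition Amx (a : nat -> R) (b : nat -> R[i]) (n : nat) : 'M[R[i]]_2 :=
  mx2 (toC (a n.*2)) 0 (b n.*2.+1) (toC (a n.*2.+1)).

Definition Bmx (b : nat -> R[i]) (c : nat -> R) (n : nat) : 'M[R[i]]_2 :=
  mx2 (toC (c n.*2)) (b n.*2) (Num.conj (b n.*2)) (toC (c n.*2.+1)).

Definition matrix_OP_recurrence (a : nat -> R) (b : nat -> R[i]) (c : nat -> R)
  (P : nat -> R -> 'M[R[i]]_2) : Prop :=
  (forall t, P 0%N t = 1%:M) /\
  (forall (n : nat) (t : R),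
     toC t *: P n t =
       Amx a b n *m P n.+1 t + Bmx b c n *m P n t
       + (if n is k.+1 then adjmx (Amx a b k) *m P k t else 0)).

Variables (H : lmodType R[i]) (U : H -> R -> 'cV[R[i]]_2) (f : nat -> H)
  (V : R -> 'M[R[i]]_2).

Definition W1 (t : R) : 'M[R[i]]_2 :=
  let u0 := U (f 0%N) t ord0 ord0 in
  let u1 := U (f 1%N) t ord0 ord0 in
  mx2 (u0 * Num.conj u0) (u0 * Num.conj u1) (Num.conj u0 * u1) (u1 * Num.conj u1).

Definition W2 (t : R) : 'M[R[i]]_2 :=
  \matrix_(i < 2, j < 2) (adjmx (U (f j) t) *m V t *m U (f i) t) ord0 ord0.

End Mats.

(* Main.v *)
Require Import Defs.
From HB Require Import structures.
From mathcomp Require Import all_boot all_order all_algebra.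
From mathcomp Require Import all_classical all_reals all_analysis.
From mathcomp Require Import complex.
From mathcomp Require Import ring lra zify.

(** The unitary U turns T into multiplication by t, so the five-term recurrence
    for T f_n becomes, almost everywhere and modulo the kernel of V(t),
    t u_n = a_n u_{n+2} + b_n u_{n+1} + c_n u_n + ... for u_n = U f_n. Grouped in
    pairs this is the matrix recurrence of the P_n; since every A_n is invertible,
    (u_{2n}, u_{2n+1}) = P_n (u_0, u_1). Hence entry (i, j) of the integral of
    P_n W P_m^* is the inner product of u_{2n+i} and u_{2m+j}, which is that of
    f_{2n+i} and f_{2m+j}. Both parts of the integral are handled as weighted
    forms h^* V g, with V = diag(1, 0) on Omega_1. *)

Set Implicit Arguments.
Unset Strict Implicit.
Unset Printing Implicit Defensive.

Import measurable_realfun.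
Import Order.TTheory GRing.Theory Num.Theory.
Local Open Scope classical_set_scope.
Local Open Scope ring_scope.

(** * Real and imaginary parts of complex numbers *)

Section ComplexParts.
Context {R : realType}.
Implicit Types z w : R[i].

Lemma cReD z w : complex.Re (z + w) = complex.Re z + complex.Re w.
Proof. by case: z; case: w. Qed.

Lemma cImD z w : complex.Im (z + w) = complex.Im z + complex.Im w.
Proof. by case: z; case: w. Qed.

Lemma cReM z w : complex.Re (z * w) =
  complex.Re z * complex.Re w - complex.Im z * complex.Im w.
Proof. by case: z; case: w. Qed.

Lemma cImM z w : complex.Im (z * w) =
  complex.Re z * complex.Im w + complex.Im z * complex.Re w.
Proof. by case: z => a b; case: w => c d /=; rewrite [b * c]mulrC. Qed.

Lemma cRe_conj z : complex.Re (Num.conj z) = complex.Re z.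
Proof. by case: z. Qed.

Lemma cIm_conj z : complex.Im (Num.conj z) = - complex.Im z.
Proof. by case: z. Qed.

Lemma ge0_complexE z : (0 <= z) = (complex.Im z == 0) && (0 <= complex.Re z).
Proof. by rewrite lecE. Qed.

Lemma complexP z w : complex.Re z = complex.Re w -> complex.Im z = complex.Im w ->
  z = w.
Proof. by case: z => a b; case: w => c d /= -> ->. Qed.

Lemma conj_toC (x : R) : Num.conj (toC x) = toC x.
Proof. by apply: complexP; rewrite ?cRe_conj ?cIm_conj //= oppr0. Qed.

End ComplexParts.

(** * Sesquilinear forms on C^2 and positive semi-definite matrices *)

Section Sesquilinear.
Context {R : realType}.
Implicit Types (M : 'M[R[i]]_2) (u v w : 'cV[R[i]]_2) (z : R[i]).

Definition sform M u v : R[i] := (adjmx v *m M *m u) ord0 ord0.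

Lemma sformE M u v :
  sform M u v = \sum_i \sum_j Num.conj (v i ord0) * M i j * u j ord0.
Proof.
rewrite /sform -mulmxA mxE; apply: eq_bigr => i _.
by rewrite !mxE mulr_sumr; apply: eq_bigr => j _; rewrite mulrA.
Qed.

Lemma sform_kerl M u v w : M *m u = M *m v -> sform M u w = sform M v w.
Proof. by rewrite /sform -!mulmxA => ->. Qed.

Lemma sformDl M u v w : sform M (u + v) w = sform M u w + sform M v w.
Proof. by rewrite /sform mulmxDr mxE. Qed.

Lemma sformZl M z u w : sform M (z *: u) w = z * sform M u w.
Proof. by rewrite /sform -scalemxAr mxE. Qed.

Lemma sform0l M w : sform M 0 w = 0.
Proof. by rewrite /sform mulmx0 mxE. Qed.

Lemma sformDr M u v w : sform M w (u + v) = sform M w u + sform M w v.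
Proof.
rewrite !sformE -big_split; apply: eq_bigr => i _ /=.
rewrite -big_split; apply: eq_bigr => j _ /=.
by rewrite mxE rmorphD /= !mulrDl.
Qed.

Lemma sformZr M z u w : sform M w (z *: u) = Num.conj z * sform M w u.
Proof.
rewrite !sformE mulr_sumr; apply: eq_bigr => i _ /=.
rewrite mulr_sumr; apply: eq_bigr => j _ /=.
by rewrite mxE rmorphM /= !mulrA.
Qed.

Section Psd.
Variables (M : 'M[R[i]]_2) (M_psd : psd2 M).

Lemma psd2_ge0 u : 0 <= complex.Re (sform M u u).
Proof. by have := M_psd u; rewrite -/(sform _ _ _) ge0_complexE => /andP[]. Qed.

Lemma psd2_real u : complex.Im (sform M u u) = 0.
Proof. by have := M_psd u; rewrite -/(sform _ _ _) ge0_complexE => /andP[/eqP]. Qed.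

(** Polarization: [psd2] only says that the diagonal values are real and nonnegative, and their
    being real at u + v and u + i v forces Hermitian symmetry. *)
Lemma psd2_herm u v : sform M v u = Num.conj (sform M u v).
Proof.
have := psd2_real (u + v); have := psd2_real (u + 'i *: v).
rewrite !sformDl !sformDr !sformZl !sformZr.
rewrite !(cImD, cReD, cImM, cReM, cRe_conj, cIm_conj, psd2_real) /=.
move=> h1 h2; apply: complexP; rewrite ?cRe_conj ?cIm_conj; lra.
Qed.

Lemma sform_kerr u v w : M *m u = M *m v -> sform M w u = sform M w v.
Proof. by move=> e; rewrite psd2_herm [RHS]psd2_herm (sform_kerl _ e). Qed.

Lemma Re_qformD u v : complex.Re (sform M (u + v) (u + v)) =
  complex.Re (sform M u u) + complex.Re (sform M v v)
  + 2 * complex.Re (sform M u v).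
Proof.
rewrite sformDl !sformDr (psd2_herm u v) !cReD cRe_conj.
set x := complex.Re _; set y := complex.Re _; set z := complex.Re _.
by clearbody x y z; ring.
Qed.

Lemma Re_qformZ z u : complex.Re (sform M (z *: u) (z *: u)) =
  csq z * complex.Re (sform M u u).
Proof.
rewrite sformZl sformZr !cReM cImM cRe_conj cIm_conj psd2_real /csq; ring.
Qed.

(** Nonnegativity of the form at u + v and u - v. This weak form of Cauchy-Schwarz later dominates
    mixed integrands by diagonal ones. *)
Lemma normr_Re_sform_le u v : `|complex.Re (sform M u v)| <=
  (complex.Re (sform M u u) + complex.Re (sform M v v)) / 2.
Proof.
have eN : complex.Re (sform M u (-1 *: v)) = - complex.Re (sform M u v).
  by rewrite sformZr rmorphN1 mulN1r; case: (sform M u v).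
have c1 : csq (-1 : R[i]) = 1 by rewrite /csq /=; ring.
move: (psd2_ge0 (u + v)) (psd2_ge0 (u + (-1) *: v)).
rewrite (Re_qformD u v) (Re_qformD u (-1 *: v)) eN (Re_qformZ (-1) v).
rewrite c1 mul1r ler_norml.
set x := complex.Re (sform M u v); set y := complex.Re (sform M u u).
set z := complex.Re _; clearbody x y z => h1 h2.
by apply/andP; split; lra.
Qed.

Lemma Re_qformD_le u v : complex.Re (sform M (u + v) (u + v)) <=
  2 * (complex.Re (sform M u u) + complex.Re (sform M v v)).
Proof.
have := normr_Re_sform_le u v; rewrite Re_qformD ler_norml => /andP[_].
set x := complex.Re (sform M u v); set y := complex.Re (sform M u u).
set z := complex.Re _; clearbody x y z => h; lra.
Qed.

Lemma psd2_ker u : complex.Re (sform M u u) = 0 -> M *m u = 0.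
Proof.
move=> u0.
have s0 w : sform M u w = 0.
  (* Since the form vanishes at u, its value at -k conj(s) u + w, with s = [sform M u w], has no
     quadratic term in k. It is affine in k with slope -2 |s|^2, so staying nonnegative for all k
     forces s = 0. *)
  have qk k : 0 <= complex.Re (sform M w w) - 2 * k * csq (sform M u w).
    have := psd2_ge0 ((- toC k * Num.conj (sform M u w)) *: u + w).
    rewrite (Re_qformD (_ *: u) w) (Re_qformZ _ u) u0 sformZl mulr0 add0r.
    congr (0 <= _ + _).
    by case: (sform M u w) => x y; rewrite /csq /=; ring.
  suff c0 : csq (sform M u w) = 0.
    move: c0; rewrite /csq => /eqP; rewrite paddr_eq0 ?sqr_ge0 //.
    by rewrite !sqrf_eq0 => /andP[/eqP ? /eqP ?]; apply: complexP.
  apply/eqP; apply: contraT => c0.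
  (* This k would give the value -q(w) - 2 < 0, where q(w) is the form at w. *)
  have := qk ((complex.Re (sform M w w) + 1) / csq (sform M u w)).
  by rewrite -mulrA divfK //; have := psd2_ge0 w; lra.
(* Testing against the basis vector of index i reads off coordinate i of M u. *)
apply/matrixP => i j; rewrite ord1 [RHS]mxE.
rewrite -(s0 (delta_mx i ord0)) /sform -mulmxA [RHS]mxE (bigD1 i) //=.
have dE k : adjmx (delta_mx i (ord0 : 'I_1)) ord0 k = (k == i)%:R :> R[i].
  by rewrite /adjmx !mxE andbT; case: (k == i); rewrite ?rmorph1 ?rmorph0.
by rewrite dE eqxx mul1r big1 ?addr0 // => k /negPf ki; rewrite dE ki mul0r.
Qed.

End Psd.
End Sesquilinear.

(** * Measurability and integration of complex-valued functions *)

Section ComplexIntegral.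
Context {R : realType}.
Variables (mu : {measure set R -> \bar R}) (A : set R).
Hypothesis mA : measurable A.
Implicit Types g h : R -> R[i].

Lemma cmeasurable_cst (z : R[i]) : cmeasurable A (fun=> z).
Proof. by split; apply: measurable_cst. Qed.

Lemma cmeasurableD g h : cmeasurable A g -> cmeasurable A h ->
  cmeasurable A (fun x => g x + h x).
Proof.
move=> [g1 g2] [h1 h2]; split.
  under eq_fun do rewrite cReD; exact: measurable_funD.
under eq_fun do rewrite cImD; exact: measurable_funD.
Qed.

Lemma cmeasurableM g h : cmeasurable A g -> cmeasurable A h ->
  cmeasurable A (fun x => g x * h x).
Proof.
move=> [g1 g2] [h1 h2]; split.
  under eq_fun do rewrite cReM.
  by apply: measurable_funB; exact: measurable_funM.
under eq_fun do rewrite cImM.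
by apply: measurable_funD; exact: measurable_funM.
Qed.

Lemma cmeasurable_conj g : cmeasurable A g ->
  cmeasurable A (fun x => Num.conj (g x)).
Proof.
move=> [g1 g2]; split; first by under eq_fun do rewrite cRe_conj.
by under eq_fun do rewrite cIm_conj; apply: measurableT_comp.
Qed.

Lemma cmeasurable_toC : cmeasurable A toC.
Proof. by split; [exact: measurable_id | exact: measurable_cst]. Qed.

Lemma cmeasurable_sum (I : Type) (r : seq I) (h : I -> R -> R[i]) :
  (forall i, cmeasurable A (h i)) -> cmeasurable A (fun x => \sum_(i <- r) h i x).
Proof.
move=> mh; elim: r => [|i r IH].
  by under eq_fun do rewrite big_nil; exact: cmeasurable_cst.
by under eq_fun do rewrite big_cons; exact: cmeasurableD.
Qed.

(** Removing the negligible set [N] makes the domination pointwise and does not affect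
    integrability. *)
Lemma ae_le_integrable (f g : R -> R) : measurable_fun A f ->
  {ae mu, forall x, A x -> `|f x| <= g x} ->
  mu.-integrable A (EFin \o g) -> mu.-integrable A (EFin \o f).
Proof.
move=> mf [N [mN N0 sN]] ig.
have mf' : measurable_fun A (EFin \o f) by exact/measurable_EFinP.
apply/(negligible_integrable mN mA mf' N0).
apply: (le_integrable _ _ _ ((negligible_integrable mN mA _ N0).1 ig)).
- exact: measurableD.
- by apply: measurable_funS mf' => // x [].
- move=> x [Ax Nx]; rewrite !abse_EFin lee_fin.
  have : `|f x| <= g x.
    by apply: contrapT => h; apply: Nx; apply: sN => /= /(_ Ax).
  by move=> /le_trans; apply; exact: ler_norm.
- exact: measurable_int ig.
Qed.

Lemma ae_eq_Rintegral (f g : R -> R) : measurable_fun A f -> measurable_fun A g ->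
  {ae mu, forall x, A x -> f x = g x} -> Rintegral mu A f = Rintegral mu A g.
Proof.
move=> mf mg fg; congr fine; apply: ae_eq_integral => //.
- exact/measurable_EFinP.
- exact/measurable_EFinP.
- by apply: filterS fg => x h Ax; rewrite h.
Qed.

Definition cintegrable h := mu.-integrable A (EFin \o (fun x => complex.Re (h x))) /\
  mu.-integrable A (EFin \o (fun x => complex.Im (h x))).

Lemma integrable_lin (a b : R) (f g : R -> R) :
  mu.-integrable A (EFin \o f) -> mu.-integrable A (EFin \o g) ->
  mu.-integrable A (EFin \o (fun x => a * f x + b * g x)).
Proof.
move=> jf jg; apply: eq_integrable
  (integrableD mA (integrableZl mA a jf) (integrableZl mA b jg)) => //.
Qed.

Lemma Rintegral_lin (a b : R) (f g : R -> R) :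
  mu.-integrable A (EFin \o f) -> mu.-integrable A (EFin \o g) ->
  Rintegral mu A (fun x => a * f x + b * g x) =
  a * Rintegral mu A f + b * Rintegral mu A g.
Proof.
move=> jf jg; rewrite RintegralD ?RintegralZl //.
  by apply: eq_integrable (integrableZl mA a jf).
by apply: eq_integrable (integrableZl mA b jg).
Qed.

Lemma cintD g h : cintegrable g -> cintegrable h ->
  cint mu A (fun x => g x + h x) = cint mu A g + cint mu A h.
Proof.
move=> [g1 g2] [h1 h2]; apply: complexP; rewrite ?cReD ?cImD /=.
  by under eq_Rintegral do rewrite cReD; rewrite RintegralD.
by under eq_Rintegral do rewrite cImD; rewrite RintegralD.
Qed.

Lemma cintZ z h : cintegrable h ->
  cint mu A (fun x => z * h x) = z * cint mu A h.
Proof.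
move=> [h1 h2]; apply: complexP; rewrite ?cReM ?cImM /=.
  under eq_Rintegral do rewrite cReM -mulNr.
  by rewrite Rintegral_lin // mulNr.
under eq_Rintegral do rewrite cImM.
by rewrite Rintegral_lin.
Qed.

Lemma cint0 : cint mu A (fun=> 0) = 0.
Proof.
by apply: complexP => /=; rewrite Rintegral_cst // mul0r.
Qed.

Lemma ae_eq_cint g h : cmeasurable A g -> cmeasurable A h ->
  {ae mu, forall x, A x -> g x = h x} -> cint mu A g = cint mu A h.
Proof.
move=> [g1 g2] [h1 h2] gh; apply: complexP; apply: ae_eq_Rintegral => //;
  by apply: filterS gh => x gh Ax; rewrite gh.
Qed.

End ComplexIntegral.

(** * Square-integrable vector functions for a single matrix weight *)

Section WeightedL2.
Context {R : realType}.
Variables (mu : {measure set R -> \bar R}) (A : set R) (V : R -> 'M[R[i]]_2)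
  (J : pred 'I_2).
Hypotheses (mA : measurable A)
  (V_J : forall x i j, ~~ (J i && J j) -> V x i j = 0)
  (mV : forall i j, cmeasurable A (fun t => V t i j))
  (psdV : {ae mu, forall t, A t -> psd2 (V t)}).
Implicit Types g h : R -> 'cV[R[i]]_2.

(* Only the coordinates in [J], outside of which [V] vanishes, are constrained:
   on [Om1] the second coordinate of a representative is arbitrary. *)
Definition wmeasurable g := forall i, J i -> cmeasurable A (fun x => g x i ord0).

Definition wL2 g := wmeasurable g /\
  mu.-integrable A (EFin \o (fun x => complex.Re (Vform V g g x))).

(** Equality of classes in the weighted space: null functions are those with values almost
    everywhere in the kernel of V, so V g is compared and not g. *)
Definition weq g h := {ae mu, forall x, A x -> V x *m g x = V x *m h x}.

Lemma wmeasurableD g h : wmeasurable g -> wmeasurable h ->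
  wmeasurable (fun x => g x + h x).
Proof.
move=> mg mh i Ji; under eq_fun do rewrite mxE.
by apply: cmeasurableD; [exact: mg | exact: mh].
Qed.

Lemma wmeasurableZ (phi : R -> R[i]) g : cmeasurable A phi -> wmeasurable g ->
  wmeasurable (fun x => phi x *: g x).
Proof.
move=> mphi mg i Ji; under eq_fun do rewrite mxE.
by apply: cmeasurableM => //; exact: mg.
Qed.

Lemma cmeasurable_Vform g h : wmeasurable g -> wmeasurable h ->
  cmeasurable A (Vform V g h).
Proof.
move=> mg mh; rewrite (_ : Vform V g h = fun x => \sum_i \sum_j
  Num.conj (h x i ord0) * V x i j * g x j ord0); last first.
  by apply/funext => x; exact: sformE.
apply: cmeasurable_sum => i; apply: cmeasurable_sum => j.
have [/andP[Ji Jj]|JN] := boolP (J i && J j); last first.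
  under eq_fun do rewrite V_J // mulr0 mul0r.
  exact: cmeasurable_cst.
apply: cmeasurableM; last exact: mg.
by apply: cmeasurableM => //; apply: cmeasurable_conj; exact: mh.
Qed.

Lemma wL2D g h : wL2 g -> wL2 h -> wL2 (fun x => g x + h x).
Proof.
move=> [mg ig] [mh ih]; have mgh := wmeasurableD mg mh; split=> //.
apply: (ae_le_integrable mA (g := fun x =>
  2 * complex.Re (Vform V g g x) + 2 * complex.Re (Vform V h h x))).
- by have [] := cmeasurable_Vform mgh mgh.
- apply: filterS psdV => x psdx Ax; have {}psdx := psdx Ax.
  by rewrite ger0_norm ?psd2_ge0 // -mulrDr; exact: Re_qformD_le.
- exact: integrable_lin.
Qed.

Lemma wL2Z (phi : R -> R[i]) (C : R) g : cmeasurable A phi ->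
  (forall x, csq (phi x) <= C) -> wL2 g -> wL2 (fun x => phi x *: g x).
Proof.
move=> mphi phiC [mg ig]; have mpg := wmeasurableZ mphi mg; split=> //.
(* The summand with coefficient 0 only gives the bound the shape of [integrable_lin]. *)
apply: (ae_le_integrable mA (g := fun x =>
  C * complex.Re (Vform V g g x) + 0 * complex.Re (Vform V g g x))).
- by have [] := cmeasurable_Vform mpg mpg.
- apply: filterS psdV => x psdx Ax; have {}psdx := psdx Ax.
  rewrite ger0_norm ?psd2_ge0 // mul0r addr0 /Vform -/(sform _ _ _).
  by rewrite Re_qformZ // ler_wpM2r ?psd2_ge0.
- exact: integrable_lin.
Qed.

Lemma ae_eq_Vform g g' h h' : weq g g' -> weq h h' ->
  {ae mu, forall x, A x -> Vform V g h x = Vform V g' h' x}.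
Proof.
move=> eg eh; apply: filterS2 psdV (filterI eg eh) => x psdx [{}eg {}eh] Ax.
have {}psdx := psdx Ax.
by rewrite /Vform -!/(sform _ _ _) (sform_kerl _ (eg Ax)) (sform_kerr psdx _ (eh Ax)).
Qed.

Lemma wL2_weq g h : wmeasurable g -> wL2 h -> weq g h -> wL2 g.
Proof.
move=> mg [mh ih] egh; split=> //.
apply: (ae_le_integrable mA (g := fun x => complex.Re (Vform V h h x))) => //.
  by have [] := cmeasurable_Vform mg mg.
apply: filterS2 psdV (ae_eq_Vform egh egh) => x psdx e Ax.
by rewrite e // ger0_norm // psd2_ge0 //; exact: psdx.
Qed.

Lemma cint_weq g g' h h' : wmeasurable g -> wmeasurable g' ->
  wmeasurable h -> wmeasurable h' -> weq g g' -> weq h h' ->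
  cint mu A (Vform V g h) = cint mu A (Vform V g' h').
Proof.
move=> mg mg' mh mh' eg eh; apply: ae_eq_cint => //.
- exact: cmeasurable_Vform.
- exact: cmeasurable_Vform.
- exact: ae_eq_Vform.
Qed.

Lemma cintegrable_Vform g h : wL2 g -> wL2 h -> cintegrable mu A (Vform V g h).
Proof.
have Re_int g' h' : wL2 g' -> wL2 h' ->
    mu.-integrable A (EFin \o (fun x => complex.Re (Vform V g' h' x))).
  move=> [mg ig] [mh ih].
  apply: (ae_le_integrable mA (g := fun x => 2^-1 * complex.Re (Vform V g' g' x)
     + 2^-1 * complex.Re (Vform V h' h' x))).
  - by have [] := cmeasurable_Vform mg mh.
  - apply: filterS psdV => x psdx Ax; have {}psdx := psdx Ax.
    by rewrite -mulrDr mulrC; exact: normr_Re_sform_le.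
  - exact: integrable_lin.
move=> g2 h2; split; first exact: Re_int.
(* The imaginary part of z is the real part of -i z, so multiplying g by -i reduces to the case of
   real parts. *)
have ig2 : wL2 (fun x => Complex 0 (-1) *: g x).
  apply: (wL2Z (phi := fun=> Complex 0 (-1)) (C := 1)) => //.
  by move=> _; rewrite /csq /= expr0n add0r sqrrN expr1n.
apply: eq_integrable (Re_int _ _ ig2 h2) => // x _.
rewrite /= /Vform -!/(sform _ _ _) sformZl cReM /=.
by rewrite mul0r sub0r mulN1r opprK.
Qed.

(** The integrand is nonnegative only almost everywhere; the absolute value makes it nonnegative at
    every point, for use with [Rintegral_ge0] and [ae_eq_integral_abs]. *)
Lemma Rintegral_qform_norm g : wL2 g ->
  complex.Re (cint mu A (Vform V g g)) =
  Rintegral mu A (fun x => `|complex.Re (Vform V g g x)|).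
Proof.
move=> [mg ig]; have [m1 _] := cmeasurable_Vform mg mg.
apply: ae_eq_Rintegral => //; first exact: measurableT_comp.
apply: filterS psdV => x psdx Ax; have {}psdx := psdx Ax.
by rewrite ger0_norm // psd2_ge0.
Qed.

Lemma cint_qform_ge0 g : wL2 g -> 0 <= complex.Re (cint mu A (Vform V g g)).
Proof. by move=> g2; rewrite Rintegral_qform_norm //; exact: Rintegral_ge0. Qed.

Lemma cint_qform_eq0 g : wL2 g -> complex.Re (cint mu A (Vform V g g)) = 0 ->
  weq g (fun=> 0).
Proof.
move=> g2; rewrite Rintegral_qform_norm //; case: g2 => mg ig => /eqP.
(* [fine] also sends the infinities to 0, so the integral must first be known to be finite. *)
rewrite fine_eq0; last first.
  rewrite -integral_fin_num_abs //.
    under eq_integral do rewrite abse_EFin normr_id -abse_EFin.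
    by move/integrableP : ig => [].
  by apply: measurableT_comp => //; have [] := cmeasurable_Vform mg mg.
move=> /eqP/(ae_eq_integral_abs mu mA (measurable_int _ ig)) q0.
apply: filterS2 psdV q0 => x psdx q0 Ax.
by rewrite mulmx0; apply: (psd2_ker (psdx Ax)); case: (q0 Ax).
Qed.

Lemma weq_sym g h : weq g h -> weq h g.
Proof. by apply: filterS => x gh Ax; rewrite gh. Qed.

Lemma weqZ (phi : R -> R[i]) g h : weq g h ->
  weq (fun x => phi x *: g x) (fun x => phi x *: h x).
Proof. by apply: filterS => x gh Ax; rewrite -!scalemxAr gh. Qed.

Lemma weq_trans g h k : weq g h -> weq h k -> weq g k.
Proof. by apply: filterS2 => x gh hk Ax; rewrite gh ?hk. Qed.

Lemma weq_sub0 g h : weq (fun x => g x - h x) (fun=> 0) -> weq g h.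
Proof.
by apply: filterS => x gh Ax; apply/eqP; rewrite -subr_eq0 -mulmxBr gh // mulmx0.
Qed.

End WeightedL2.

(** * The matrix three-term recurrence and its solutions *)

Section BlockRecurrence.
Context {R : realType}.
Variables (a : nat -> R) (b : nat -> R[i]) (c : nat -> R).
Hypothesis a_gt0 : forall n, 0 < a n.

Lemma Amx_unit n : Amx a b n \in unitmx.
Proof.
rewrite unitmxE det_trig.
  rewrite !big_ord_recl big_ord0 mulr1 !mxE /= unitfE mulf_neq0 //;
    by rewrite /toC eq_complex /= eqxx andbT gt_eqF.
by apply/is_trig_mxP => -[[|[|//]] ?] [[|[|//]] ?] //= _; rewrite mxE.
Qed.

(** Strong induction: since A_n is invertible, the recurrence expresses P_{n+1} through P_n and
    P_{n-1} by constant matrices and multiplication by t. *)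
Lemma cmeasurable_matrix_OP (A : set R) (P : nat -> R -> 'M[R[i]]_2) :
  measurable A -> matrix_OP_recurrence a b c P ->
  forall n i j, cmeasurable A (fun t => P n t i j).
Proof.
move=> mA [P0 Prec].
have mul (M : 'M[R[i]]_2) (Q : R -> 'M[R[i]]_2) :
    (forall i j, cmeasurable A (fun t => Q t i j)) ->
    forall i j, cmeasurable A (fun t => (M *m Q t) i j).
  move=> mQ i j; under eq_fun do rewrite mxE.
  apply: cmeasurable_sum => k; apply: cmeasurableM; last exact: mQ.
  exact: cmeasurable_cst.
elim/ltn_ind => n IH i j; case: n IH => [|n] IH.
  by under eq_fun do rewrite P0; exact: cmeasurable_cst.
(* Subtraction is written as left multiplication by -I, so that [mul] covers it too. *)
have -> : (fun t => P n.+1 t i j) = fun t => (invmx (Amx a b n) *m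
    (toC t *: P n t + -1%:M *m (Bmx b c n *m P n t +
    (if n is k.+1 then adjmx (Amx a b k) *m P k t else 0)))) i j.
  apply/funext => t; congr (fun_of_matrix _ i j).
  rewrite mulNmx mul1mx Prec -(addrA (Amx a b n *m _)) addrK mulKmx //; exact: Amx_unit.
refine (mul _ (fun t => _) _ i j) => i1 j1; under eq_fun do rewrite mxE [X in X + _]mxE.
apply: cmeasurableD; first by apply: cmeasurableM; [exact: cmeasurable_toC | exact: IH].
refine (mul _ (fun t => _) _ i1 j1) => i2 j2; under eq_fun do rewrite mxE.
apply: cmeasurableD; first by refine (mul _ _ _ i2 j2) => ? ?; exact: IH.
case: n IH => [|n] IH; last first.
  by refine (mul _ _ _ i2 j2) => ? ?; exact: IH.
by under eq_fun do rewrite mxE; exact: cmeasurable_cst.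
Qed.

(** Two consecutive steps of the scalar five-term recurrence form one step of the matrix recurrence,
    whose solutions are determined by their initial value because every A_n is invertible. The point
    t is fixed and [w] takes vector values, so that it can be V(t) u_n(t). *)
Lemma matrix_OP_solves (t : R) (P : nat -> 'M[R[i]]_2) (w : nat -> 'cV[R[i]]_2) :
  P 0%N = 1%:M ->
  (forall n, toC t *: P n = Amx a b n *m P n.+1 + Bmx b c n *m P n
       + (if n is k.+1 then adjmx (Amx a b k) *m P k else 0)) ->
  (forall n, toC t *: w n =
     toC (a n) *: w n.+2 + b n *: w n.+1 + toC (c n) *: w n
     + (if n is k.+1 then Num.conj (b k) *: w k else 0)
     + (if n is k.+2 then toC (a k) *: w k else 0)) ->
  forall n (i : 'I_2), w (n.*2 + i)%N = \sum_(k < 2) P n i k *: w k.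
Proof.
move=> P0 Prec wrec.
(* The rows of X_n are the transposes of w_{2n} and w_{2n+1}. *)
pose X n : 'M[R[i]]_2 := \matrix_(i, j) w (n.*2 + i)%N j ord0.
have Xrec n : toC t *: X n = Amx a b n *m X n.+1 + Bmx b c n *m X n
    + (if n is k.+1 then adjmx (Amx a b k) *m X k else 0).
  have w0 := wrec n.*2; have w1 := wrec n.*2.+1.
  apply/matrixP => i j.
  move: w0 w1 => /matrixP/(_ j ord0) w0 /matrixP/(_ j ord0) w1.
  rewrite !mxE !big_ord_recl !big_ord0 !mxE /=.
  move: i => [[|[|//]] ?] /=; rewrite ?addn0 ?addn1 /bump /=;
    case: n w0 w1 => [|n] /=; rewrite ?doubleS => w0 w1;
    rewrite !mxE ?big_ord_recl ?big_ord0 ?mxE /bump /= ?addn0 ?addn1;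
    rewrite ?rmorph0 ?conj_toC.
  - by move: w0; rewrite !mxE => ->; ring.
  - by move: w0; rewrite !mxE => ->; ring.
  - by move: w1; rewrite !mxE => ->; ring.
  - by move: w1; rewrite !mxE => ->; ring.
have XP n : X n = P n *m X 0%N.
  elim/ltn_ind: n => -[|n] IH; first by rewrite P0 mul1mx.
  (* A_n can be cancelled; by induction the remaining terms of the recurrences for X and for P X_0
     agree. *)
  suff e : Amx a b n *m X n.+1 = Amx a b n *m (P n.+1 *m X 0%N).
    by rewrite -(mulKmx (Amx_unit n) (X n.+1)) e mulKmx // Amx_unit.
  have := Xrec n; rewrite (IH n) // scalemxAl Prec !mulmxDl -!mulmxA.
  case: n IH => [|n] IH; first by rewrite mul0mx !addr0 => /addIr.
  by rewrite (IH n) 1?ltnW // -!mulmxA => /addIr/addIr.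
move=> n i; apply/matrixP => j l; rewrite ord1 summxE.
have := XP n => /matrixP/(_ i j); rewrite !mxE => ->.
by apply: eq_bigr => k _; rewrite !mxE.
Qed.

End BlockRecurrence.

(** * The space L^2(V) as a pair of weighted spaces *)

Section L2V.
Context {R : realType}.
Variables (Om1 Om2 : set R) (sigma rho : {measure set R -> \bar R})
  (V : R -> 'M[R[i]]_2).
Hypotheses (mOm1 : measurable Om1) (mOm2 : measurable Om2)
  (mV : forall i j, cmeasurable Om2 (fun t => V t i j))
  (psdV : {ae rho, forall t, Om2 t -> psd2 (V t)}).
Implicit Types g h : R -> 'cV[R[i]]_2.

(** This weight turns the scalar integrand g conj(h) on [Om1] into a form of the same kind as on
    [Om2], so one set of weighted lemmas serves both. *)
Definition V1 (_ : R) : 'M[R[i]]_2 := delta_mx ord0 ord0.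

Local Notation J1 := (pred1 (ord0 : 'I_2)).
Local Notation J2 := (predT : pred 'I_2).

Lemma sform_V1 t u v : sform (V1 t) u v = u ord0 ord0 * Num.conj (v ord0 ord0).
Proof.
rewrite sformE !big_ord_recl !big_ord0 !mxE /=.
by rewrite !mulr0 !mul0r !addr0 mulr1 mulrC.
Qed.

Lemma V1_J x i j : ~~ (J1 i && J1 j) -> V1 x i j = 0.
Proof. by rewrite mxE => /negPf /= ->. Qed.

Lemma V_J2 x i j : ~~ (J2 i && J2 j) -> V x i j = 0. Proof. by []. Qed.

Lemma cmeasurable_V1 i j : cmeasurable Om1 (fun t => V1 t i j).
Proof. exact: cmeasurable_cst. Qed.

Lemma psd2_V1 : {ae sigma, forall t, Om1 t -> psd2 (V1 t)}.
Proof.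
by apply: aeW => t _ v; rewrite -/(sform _ _ _) sform_V1; exact: mulcJ_ge0.
Qed.

Local Notation wL2_1 := (wL2 sigma Om1 V1 J1).
Local Notation wL2_2 := (wL2 rho Om2 V J2).

Definition mL2V g := wmeasurable Om1 J1 g /\ wmeasurable Om2 J2 g.
Definition weqV g h := weq sigma Om1 V1 g h /\ weq rho Om2 V g h.

Lemma ipVE g h : ipV sigma rho Om1 Om2 V g h =
  cint sigma Om1 (Vform V1 g h) + cint rho Om2 (Vform V g h).
Proof.
by rewrite /ipV; congr (cint _ _ _ + _); apply/funext => x; rewrite -(sform_V1 x).
Qed.

Lemma inL2VE g : inL2V sigma rho Om1 Om2 V g <-> wL2_1 g /\ wL2_2 g.
Proof.
have E x : csq (g x ord0 ord0) = complex.Re (Vform V1 g g x).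
  by rewrite /Vform -/(sform _ _ _) sform_V1; case: (g x _ _) => p q; rewrite /csq /=; ring.
have E' : (fun x => (csq (g x ord0 ord0))%:E) =
    EFin \o (fun x => complex.Re (Vform V1 g g x)).
  by apply/funext => x; rewrite E.
rewrite /inL2V E'; split=> [[m1 m2 m3 i1 i2]|[[m1 i1] [m2 i2]]].
  split; split=> //; first by move=> i /eqP ->.
  move=> i _; have [->|->] // : i = ord0 \/ i = ord_max.
  by case: i => [[|[|//]] ?]; [left|right]; exact: val_inj.
by split=> //; [exact: m1 | exact: m2 | exact: m2].
Qed.

Local Notation L2V := (inL2V sigma rho Om1 Om2 V).
Local Notation ip2 := (ipV sigma rho Om1 Om2 V).

Lemma L2V_meas g : L2V g -> mL2V g.
Proof. by move=> /inL2VE[[? _] [? _]]. Qed.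

Lemma L2VD g h : L2V g -> L2V h -> L2V (fun x => g x + h x).
Proof.
move=> /inL2VE[g1 g2] /inL2VE[h1 h2]; apply/inL2VE; split.
  exact: (wL2D mOm1 V1_J cmeasurable_V1 psd2_V1).
exact: (wL2D mOm2 V_J2).
Qed.

Lemma L2VZ (phi : R -> R[i]) (C : R) g :
  cmeasurable Om1 phi -> cmeasurable Om2 phi ->
  (forall x, csq (phi x) <= C) -> L2V g -> L2V (fun x => phi x *: g x).
Proof.
move=> m1 m2 phiC /inL2VE[g1 g2]; apply/inL2VE; split.
  exact: (wL2Z mOm1 V1_J cmeasurable_V1 psd2_V1 _ phiC).
exact: (wL2Z mOm2 V_J2 mV psdV _ phiC).
Qed.

Lemma L2VZc z g : L2V g -> L2V (fun x => z *: g x).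
Proof.
apply: (@L2VZ (fun=> z) (csq z)) => //; exact: cmeasurable_cst.
Qed.

Lemma L2V0 : L2V (fun=> 0).
Proof.
apply/inL2VE; split; split.
1,3: by move=> i _; under eq_fun do rewrite mxE; exact: cmeasurable_cst.
  rewrite (_ : _ \o _ = cst 0%E); first exact: integrable0.
  by apply/funext => x /=; rewrite /Vform -/(sform _ _ _) sform0l.
rewrite (_ : _ \o _ = cst 0%E); first exact: integrable0.
by apply/funext => x /=; rewrite /Vform -/(sform _ _ _) sform0l.
Qed.

Lemma L2V_sum (I : Type) (r : seq I) (G : I -> R -> 'cV[R[i]]_2) :
  (forall i, L2V (G i)) -> L2V (fun x => \sum_(i <- r) G i x).
Proof.
move=> GL; elim: r => [|i r IH].
  by under eq_fun do rewrite big_nil; exact: L2V0.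
by under eq_fun do rewrite big_cons; exact: L2VD.
Qed.

Lemma L2V_weqV g h : mL2V g -> L2V h -> weqV g h -> L2V g.
Proof.
move=> [m1 m2] /inL2VE[h1 h2] [e1 e2]; apply/inL2VE; split.
  exact: (wL2_weq mOm1 V1_J cmeasurable_V1 psd2_V1 m1 h1).
exact: (wL2_weq mOm2 V_J2 mV psdV m2 h2).
Qed.

Lemma ipV_weqV g g' h h' : mL2V g -> mL2V g' -> mL2V h -> mL2V h' ->
  weqV g g' -> weqV h h' -> ip2 g h = ip2 g' h'.
Proof.
move=> [g1 g2] [g1' g2'] [h1 h2] [h1' h2'] [eg1 eg2] [eh1 eh2]; rewrite !ipVE.
congr (_ + _).
  exact: (cint_weq mOm1 V1_J cmeasurable_V1 psd2_V1 g1 g1' h1 h1').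
exact: (cint_weq mOm2 V_J2 mV psdV g2 g2' h2 h2').
Qed.

Lemma ipV_qform_eq0 g : L2V g -> ip2 g g = 0 -> weqV g (fun=> 0).
Proof.
move=> /inL2VE[g1 g2]; rewrite ipVE => /(congr1 (@complex.Re R)).
rewrite cReD => /eqP; rewrite paddr_eq0; first last.
- exact: (cint_qform_ge0 mOm2 V_J2).
- exact: (cint_qform_ge0 mOm1 V1_J cmeasurable_V1 psd2_V1).
move=> /andP[/eqP q1 /eqP q2]; split.
  exact: (cint_qform_eq0 mOm1 V1_J cmeasurable_V1 psd2_V1 g1).
exact: (cint_qform_eq0 mOm2 V_J2 mV psdV g2).
Qed.

Lemma ipVDl g g' h : L2V g -> L2V g' -> L2V h ->
  ip2 (fun x => g x + g' x) h = ip2 g h + ip2 g' h.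
Proof.
move=> /inL2VE[g1 g2] /inL2VE[g1' g2'] /inL2VE[h1 h2]; rewrite !ipVE.
rewrite addrACA; congr (_ + _).
  rewrite -(cintD mOm1 (cintegrable_Vform mOm1 V1_J cmeasurable_V1 psd2_V1 g1 h1)
   (cintegrable_Vform mOm1 V1_J cmeasurable_V1 psd2_V1 g1' h1)).
  by congr cint; apply/funext => x; exact: sformDl.
rewrite -(cintD mOm2 (cintegrable_Vform mOm2 V_J2 mV psdV g2 h2)
  (cintegrable_Vform mOm2 V_J2 mV psdV g2' h2)).
by congr cint; apply/funext => x; exact: sformDl.
Qed.

Lemma ipVZl z g h : L2V g -> L2V h ->
  ip2 (fun x => z *: g x) h = z * ip2 g h.
Proof.
move=> /inL2VE[g1 g2] /inL2VE[h1 h2]; rewrite !ipVE mulrDr; congr (_ + _).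
  rewrite -(cintZ mOm1 z (cintegrable_Vform mOm1 V1_J cmeasurable_V1 psd2_V1 g1 h1)).
  by congr cint; apply/funext => x; exact: sformZl.
rewrite -(cintZ mOm2 z (cintegrable_Vform mOm2 V_J2 mV psdV g2 h2)).
by congr cint; apply/funext => x; exact: sformZl.
Qed.

Lemma ipV0l h : ip2 (fun=> 0) h = 0.
Proof.
rewrite ipVE -[RHS]addr0; congr (_ + _).
  by rewrite -(cint0 sigma mOm1); congr cint; apply/funext => x; exact: sform0l.
by rewrite -(cint0 rho mOm2); congr cint; apply/funext => x; exact: sform0l.
Qed.

Lemma ipV_suml (I : Type) (r : seq I) (G : I -> R -> 'cV[R[i]]_2) h :
  (forall i, L2V (G i)) -> L2V h ->
  ip2 (fun x => \sum_(i <- r) G i x) h = \sum_(i <- r) ip2 (G i) h.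
Proof.
move=> GL hL; elim: r => [|i r IH].
  by rewrite big_nil -[RHS](ipV0l h); congr ipV; apply/funext => x; rewrite big_nil.
rewrite big_cons -IH -ipVDl //; last exact: L2V_sum.
by congr ipV; apply/funext => x; rewrite big_cons.
Qed.

(** For moving scalar factors from one argument to the other; quantifying over all [M] covers both
    weights at once. *)
Lemma ipV_pointwise g h g' h' : (forall M t, sform M (g t) (h t) = sform M (g' t) (h' t)) ->
  ip2 g h = ip2 g' h'.
Proof.
by move=> e; rewrite !ipVE; congr (cint _ _ _ + cint _ _ _); apply/funext => t;
  exact: e.
Qed.

Lemma weqVZ (phi : R -> R[i]) g h : weqV g h ->
  weqV (fun x => phi x *: g x) (fun x => phi x *: h x).
Proof. by move=> [? ?]; split; exact: weqZ. Qed.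

Lemma weqV_refl g : weqV g g.
Proof. by split; apply: aeW. Qed.

Lemma weqV_sym g h : weqV g h -> weqV h g.
Proof. by move=> [? ?]; split; exact: weq_sym. Qed.

Lemma weqV_trans g h k : weqV g h -> weqV h k -> weqV g k.
Proof.
by move=> [gh1 gh2] [hk1 hk2]; split; [exact: weq_trans hk1 | exact: weq_trans hk2].
Qed.

Lemma L2null_weqV g h : L2V g -> L2V h ->
  L2null sigma rho Om1 Om2 V (fun t => g t - h t) -> weqV g h.
Proof.
move=> gL hL n0.
have /ipV_qform_eq0/(_ n0)[e1 e2] : L2V (fun t => g t - h t).
  under eq_fun do rewrite -scaleN1r.
  by apply: L2VD => //; exact: L2VZc.
by split; exact: weq_sub0.
Qed.

End L2V.

(** * A bounded multiplier that stays bounded after multiplication by t *)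

Section Damping.
Context {R : realType}.

(** Both [damp t] and [t * damp t] have modulus at most 1, so damping maps L^2(V) into the domain of
    multiplication by t. *)
Definition damp (t : R) : R := (1 + t ^+ 2)^-1.

Lemma damp_gt0 t : 0 < damp t.
Proof. by rewrite invr_gt0 ltr_pwDl // sqr_ge0. Qed.

Lemma measurable_damp (A : set R) : measurable_fun A damp.
Proof.
apply: (@measurable_funS _ _ _ _ setT) => //.
apply: continuous_measurable_fun => t.
apply: cvgV; first by rewrite gt_eqF // ltr_pwDl // sqr_ge0.
by apply: cvgD; [exact: cvg_cst | exact: exprn_continuous].
Qed.

Lemma cmeasurable_damp (A : set R) : cmeasurable A (fun t => toC (damp t)).
Proof. by split; [exact: measurable_damp | exact: measurable_cst]. Qed.

Lemma csq_toC (x : R) : csq (toC x) = x ^+ 2.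
Proof. by rewrite /csq /= expr0n addr0. Qed.

Lemma toCM (x y : R) : toC (x * y) = toC x * toC y.
Proof. by apply: complexP; rewrite ?cReM ?cImM /= ?(mulr0, mul0r, subr0, addr0). Qed.

Lemma csq_damp_le1 t : csq (toC (damp t)) <= 1.
Proof.
rewrite csq_toC expr_le1 //; last exact/ltW/damp_gt0.
by rewrite /damp invf_le1 ?lerDl ?sqr_ge0 // ltr_pwDl // sqr_ge0.
Qed.

Lemma csq_idM_damp_le1 t : csq (toC (t * damp t)) <= 1.
Proof.
have t1 : 0 < 1 + t ^+ 2 by rewrite ltr_pwDl // sqr_ge0.
rewrite csq_toC /damp expr_div_n ler_pdivrMr ?exprn_gt0 // mul1r.
by have := sqr_ge0 t; nra.
Qed.

Lemma cmeasurable_idM_damp (A : set R) : cmeasurable A (fun t => toC (t * damp t)).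
Proof.
split; last exact: measurable_cst.
by apply: measurable_funM; [exact: measurable_id | exact: measurable_damp].
Qed.

End Damping.

(** * The operator T as multiplication by t, almost everywhere *)

Section Multiplication.
Context {R : realType} {H : lmodType R[i]}.
Variables (ip : H -> H -> R[i]) (D : set H) (T : H -> H)
  (Om1 Om2 : set R) (sigma rho : {measure set R -> \bar R})
  (V : R -> 'M[R[i]]_2) (U : H -> R -> 'cV[R[i]]_2).
Hypotheses (ipP : inner_product_axioms ip)
  (T_sym : forall x y, D x -> D y -> ip (T x) y = ip x (T y))
  (mOm1 : measurable Om1) (mOm2 : measurable Om2)
  (mV : forall i j, cmeasurable Om2 (fun t => V t i j))
  (psdV : {ae rho, forall t, Om2 t -> psd2 (V t)})
  (U_unitary : unitary_to_L2V sigma rho Om1 Om2 V ip U)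
  (U_mult : intertwines_mult sigma rho Om1 Om2 V D T U).

Local Notation L2V := (inL2V sigma rho Om1 Om2 V).
Local Notation ip2 := (ipV sigma rho Om1 Om2 V).
Local Notation weqV := (weqV Om1 Om2 sigma rho V).

(** [U x] is only a representative of a class, so [Ulincomb] combines chosen representatives; it is
    related to [U (lincomb s)] through inner products only. *)
Let lincomb (s : seq (R[i] * H)) := \sum_(e <- s) e.1 *: e.2.
Let Ulincomb (s : seq (R[i] * H)) t := \sum_(e <- s) e.1 *: U e.2 t.

Lemma ip_suml s y : ip (lincomb s) y = \sum_(e <- s) e.1 * ip e.2 y.
Proof.
have [ipl _ _ _] := ipP; rewrite /lincomb.
elim: s => [|e s IH]; last by rewrite !big_cons ipl IH.
rewrite !big_nil; have := ipl 1 0 0 y; rewrite scale1r addr0 mul1r => e0.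
by apply: (@addrI _ (ip 0 y)); rewrite addr0.
Qed.

(* [L2null] also holds when the defining integral diverges, because
   [Rintegral] is then 0; so the relation U T x = t U x given for [x] in [D]
   says nothing unless t U x is already known to be square integrable. It is
   recovered from the symmetry of [T] by testing against the preimage of the
   damped defect. *)
Lemma U_mult_ae s x : D x -> T x = lincomb s ->
  weqV (fun t => toC t *: U x t) (Ulincomb s).
Proof.
move=> Dx Tx; have [UL Uip Usurj] := U_unitary; have [TM MD] := U_mult.
have SL : L2V (Ulincomb s).
  by apply: L2V_sum => // e; exact: L2VZc.
(* [g'] is the damped defect S - t U x, with S = [Ulincomb s]. The factors are distributed because t
   U x alone is not known to be square integrable. The second damping in [g] brings t g into L^2(V)
   as well. *)
pose g' t : 'cV[R[i]]_2 := toC (damp t) *: Ulincomb s t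
   + (-1) *: (toC (t * damp t) *: U x t).
pose g t := toC (damp t) *: g' t.
have dampL h : L2V h -> L2V (fun t => toC (damp t) *: h t).
  apply: (L2VZ mOm1 mOm2 mV psdV (C := 1)); last exact: csq_damp_le1.
    exact: cmeasurable_damp.
  exact: cmeasurable_damp.
have idampL h : L2V h -> L2V (fun t => toC (t * damp t) *: h t).
  apply: (L2VZ mOm1 mOm2 mV psdV (C := 1)); last exact: csq_idM_damp_le1.
    exact: cmeasurable_idM_damp.
  exact: cmeasurable_idM_damp.
have g'L : L2V g'.
  have := idampL _ (UL x); move/(L2VZc mOm1 mOm2 mV psdV (-1)).
  exact: (L2VD mOm1 mOm2 mV psdV (dampL _ SL)).
have gL : L2V g by exact: dampL.
have tgE : (fun t => toC t *: g t) = fun t => toC (t * damp t) *: g' t.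
  by apply/funext => t; rewrite scalerA toCM.
have tgL : L2V (fun t => toC t *: g t) by rewrite tgE; exact: idampL.
have [y /L2null_weqV Uyg] := Usurj _ gL.
have {}Uyg : weqV (U y) g by exact: Uyg.
have tUy_g : weqV (fun t => toC t *: U y t) (fun t => toC t *: g t).
  exact: weqVZ.
have mtUy : mL2V Om1 Om2 (fun t => toC t *: U y t).
  have [m1 m2] := L2V_meas (UL y).
  by split; apply: wmeasurableZ => //; exact: cmeasurable_toC.
have tUyL : L2V (fun t => toC t *: U y t) by exact: L2V_weqV tgL tUy_g.
(* As t U y is square integrable, the domain condition puts y in [D], and there U T y = t U y can be
   read as an equality of classes. *)
have Dy : D y by exact: MD.
have UTy : weqV (U (T y)) (fun t => toC t *: U y t).
  by apply: L2null_weqV => //; exact: TM.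
have Ugy h : L2V h -> ip2 h g = ip2 h (U y).
  move=> hL; apply: (ipV_weqV mOm1 mOm2 mV psdV).
  - exact: L2V_meas hL.
  - exact: L2V_meas hL.
  - exact: L2V_meas gL.
  - exact: L2V_meas (UL y).
  - exact: weqV_refl.
  - exact: weqV_sym.
(* The chain is <S, g> = <T x, y> = <x, T y> = <U x, t g>. *)
have sgE : ip2 (Ulincomb s) g = ip2 (U x) (fun t => toC t *: g t).
  have -> : ip2 (Ulincomb s) g = ip (T x) y.
    rewrite Tx ip_suml [LHS](ipV_suml mOm1 mOm2 mV psdV s _ gL); last first.
      by move=> e; exact: (L2VZc mOm1 mOm2 mV psdV _ (UL e.2)).
    apply: eq_bigr => e _.
    rewrite [LHS](ipVZl mOm1 mOm2 mV psdV e.1 (UL e.2) gL) -(Uip e.2 y).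
    by rewrite (Ugy _ (UL e.2)).
  rewrite (T_sym Dx Dy) -(Uip x (T y)); apply: (ipV_weqV mOm1 mOm2 mV psdV).
  - exact: L2V_meas (UL x).
  - exact: L2V_meas (UL x).
  - exact: L2V_meas (UL (T y)).
  - exact: L2V_meas tgL.
  - exact: weqV_refl.
  - exact: weqV_trans UTy tUy_g.
(* Moving one real damping factor to the first argument gives <g', g'> = <S, g> - <U x, t g>. *)
have : ip2 g' g' = 0.
  have Sg' : ip2 (Ulincomb s) g = ip2 (fun t => toC (damp t) *: Ulincomb s t) g'.
    by apply: ipV_pointwise => M t; rewrite sformZr conj_toC sformZl.
  have Ug' : ip2 (U x) (fun t => toC t *: g t) =
      ip2 (fun t => toC (t * damp t) *: U x t) g'.
    by rewrite tgE; apply: ipV_pointwise => M t; rewrite sformZr conj_toC sformZl.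
  have dSL := dampL _ SL; have iUL := idampL _ (UL x).
  rewrite [LHS](ipVDl mOm1 mOm2 mV psdV dSL (L2VZc mOm1 mOm2 mV psdV (-1) iUL) g'L).
  by rewrite (ipVZl mOm1 mOm2 mV psdV (-1) iUL g'L) -Sg' -Ug' sgE mulN1r subrr.
move=> /ipV_qform_eq0 => /(_ mOm1 mOm2 mV psdV g'L) [e1 e2].
(* The damping factor never vanishes and can be divided out. *)
have undamp A (mu : {measure set R -> \bar R}) W :
    weq mu A W g' (fun=> 0) ->
    weq mu A W (fun t => toC t *: U x t) (Ulincomb s).
  apply: filterS => t h At; have := h At; rewrite mulmx0 /g' toCM.
  have d0 : toC (damp t) != 0 by rewrite eq_complex /= eqxx andbT gt_eqF ?damp_gt0.
  rewrite mulrC -scalerA [_ *: (toC (damp t) *: _)]scalerA mulrC -scalerA -scalerDr.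
  rewrite -scalemxAr => /eqP; rewrite scaler_eq0 (negPf d0) /= scaleN1r.
  by rewrite mulmxBr subr_eq0 => /eqP.
by split; exact: undamp.
Qed.

End Multiplication.

(** * Gram matrices and the orthonormality relation *)

Lemma mulmx_sformE {R : realType} (M P Q : 'M[R[i]]_2) (u : 'I_2 -> 'cV[R[i]]_2) i j :
  (P *m (\matrix_(k, l) sform M (u k) (u l)) *m adjmx Q) i j =
  sform M (\sum_k P i k *: u k) (\sum_l Q j l *: u l).
Proof.
rewrite !big_ord_recl !big_ord0 !addr0 !sformDl !sformDr !sformZl !sformZr.
by rewrite !mxE !big_ord_recl !big_ord0 !mxE !big_ord_recl !big_ord0 !mxE; ring.
Qed.

Theorem theorem6p3 (R : realType) (H : lmodType R[i]) (ip : H -> H -> R[i])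
  (D : set H) (T : H -> H) (f : nat -> H)
  (a : nat -> R) (b : nat -> R[i]) (c : nat -> R)
  (Om1 Om2 : set R) (sigma rho : {measure set R -> \bar R})
  (V : R -> 'M[R[i]]_2) (U : H -> R -> 'cV[R[i]]_2)
  (P : nat -> R -> 'M[R[i]]_2) :
  hilbert_space ip ->
  self_adjoint ip D T ->
  orthonormal_basis ip f ->
  (forall n, D (f n)) ->
  (forall n, 0 < a n) ->
  (forall n, T (f n) =
     toC (a n) *: f n.+2 + b n *: f n.+1 + toC (c n) *: f n
     + (if n is k.+1 then Num.conj (b k) *: f k else 0)
     + (if n is k.+2 then toC (a k) *: f k else 0)) ->
  measurable Om1 -> measurable Om2 -> Om1 `&` Om2 = set0 ->
  spectrum ip D T = toC @` (Om1 `|` Om2) ->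
  sigma (~` Om1) = 0%E -> rho (~` Om2) = 0%E ->
  (forall i j, cmeasurable Om2 (fun t => V t i j)) ->
  {ae rho, forall t, Om2 t -> psd2 (V t)} ->
  unitary_to_L2V sigma rho Om1 Om2 V ip U ->
  intertwines_mult sigma rho Om1 Om2 V D T U ->
  matrix_OP_recurrence a b c P ->
  forall n m : nat,
    mxint sigma Om1 (fun t => P n t *m W1 U f t *m adjmx (P m t))
    + mxint rho Om2 (fun t => P n t *m W2 U f V t *m adjmx (P m t))
    = (n == m)%:R%:M.
Proof.
move=> [ipP _] [_ T_sym _] [f_on _] Df a_gt0 Tf mOm1 mOm2 _ _ _ _ mV psdV
  U_unitary U_mult P_rec n m.
have [UL Uip _] := U_unitary.
(* The terms of T f_n as a list, without the boundary terms of negative index. *)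
pose s n := [:: (toC (a n), f n.+2); (b n, f n.+1); (toC (c n), f n)]
  ++ (if n is k.+1 then [:: (Num.conj (b k), f k)] else [::])
  ++ (if n is k.+2 then [:: (toC (a k), f k)] else [::]).
(* Stated for any [F], to expand both T f_n, with the identity, and the sum of representatives at a
   point t. *)
have sE (W : lmodType R[i]) (F : H -> W) k : \sum_(e <- s k) e.1 *: F e.2 =
    toC (a k) *: F (f k.+2) + b k *: F (f k.+1) + toC (c k) *: F (f k)
    + (if k is l.+1 then Num.conj (b l) *: F (f l) else 0)
    + (if k is l.+2 then toC (a l) *: F (f l) else 0).
  by case: k => [|[|k]]; rewrite /s !big_cat !big_cons !big_nil /= !addr0 ?addrA.
have mult k : weqV Om1 Om2 sigma rho V (fun t => toC t *: U (f k) t)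
    (fun t => \sum_(e <- s k) e.1 *: U e.2 t).
  apply: (U_mult_ae ipP T_sym mOm1 mOm2 mV psdV U_unitary U_mult (Df k)).
  by rewrite Tf (sE _ id).
(* Row i of P_k applied to the pair (u_0, u_1). *)
pose G k (i : 'I_2) t := \sum_(l < 2) P k t i l *: U (f l) t.
have solve (mu : {measure set R -> \bar R}) A W :
    (forall k, weq mu A W (fun t => toC t *: U (f k) t)
       (fun t => \sum_(e <- s k) e.1 *: U e.2 t)) ->
    forall k i, weq mu A W (G k i) (U (f (k.*2 + i)%N)).
  (* The countably many exceptional sets are merged first. Off their union the recurrence holds
     exactly, for all indices at once, for the vectors W(t) u_n(t). *)
  move=> /ae_foralln wmult k i; apply: filterS wmult => t wmult At.
  have [P0 Prec] := P_rec.
  rewrite [RHS](matrix_OP_solves a_gt0 (b := b) (c := c) (t := t) (P := P ^~ t)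
    (w := fun k => W t *m U (f k) t)) //.
    by rewrite mulmx_sumr; apply: eq_bigr => l _; rewrite -scalemxAr.
  move=> l; have := wmult l At; rewrite -scalemxAr (sE _ (U ^~ t)) => ->.
  by rewrite !mulmxDr -!scalemxAr; case: l => [|[|l]]; rewrite ?mulmx0 -?scalemxAr.
have mG k i : mL2V Om1 Om2 (G k i).
  have m0 A J : measurable A -> (forall x, wmeasurable A J (U x)) -> wmeasurable A J (G k i).
    move=> mA mU j Jj; under eq_fun do rewrite summxE.
    apply: cmeasurable_sum => l; under eq_fun do rewrite mxE.
    apply: cmeasurableM; last exact: mU.
    exact: cmeasurable_matrix_OP P_rec _ _ _.
  by split; apply: m0 => // x; have [] := L2V_meas (UL x).
apply/matrixP => i j.
(* [W1] is the Gram matrix of u_0, u_1 for the weight [V1], and [W2] the one for V, so each entry of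
   the integrands is a form evaluated at [G n i] and [G m j]. *)
transitivity (ipV sigma rho Om1 Om2 V (G n i) (G m j)).
  rewrite ipVE !mxE; congr (cint _ _ _ + cint _ _ _); apply/funext => t.
    rewrite /Vform -/(sform _ _ _) -mulmx_sformE; congr ((_ *m _ *m _) i j).
    by apply/matrixP => -[[|[|//]] ?] [[|[|//]] ?]; rewrite !mxE sform_V1 //= mulrC.
  by rewrite /Vform -/(sform _ _ _) -mulmx_sformE.
transitivity (ipV sigma rho Om1 Om2 V (U (f (n.*2 + i)%N)) (U (f (m.*2 + j)%N))).
  apply: ipV_weqV => //; try exact: L2V_meas.
    by split; apply: solve => k; have [] := mult k.
  by split; apply: solve => k; have [] := mult k.
(* As i, j < 2, the equality 2n + i = 2m + j holds exactly when n = m and i = j. *)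
rewrite Uip f_on mxE -mulrnA mulnb; congr (_%:R); congr nat_of_bool.
by case: i j => [[|[|//]] ?] [[|[|//]] ?]; rewrite -val_eqE /=; lia.
Qed.
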